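(* Let $m\equiv 11 \pmod{24}$ be a square-free positive integer. Then $$R(m,5x^2+2xy+11y^2)\equiv 2 \pmod 4$$ if and only if $m$ can be written in one of the following two forms: (i) $m=p_1\cdots p_{2t_1-1}\cdot \overline{p}_1\cdots\overline{p}_{2t_2}\cdot q_1\cdots q_{t_3}\cdot\overline{q}_1\cdots\overline{q}_{2t_4}$; (ii) $m=p_1\cdots p_{2t_1}\cdot \overline{p}_1\cdots\overline{p}_{2t_2-1}\cdot q_1\cdots q_{t_3}\cdot\overline{q}_1\cdots\overline{q}_{2t_4-1}$; where all $p_i\in\mathscr{S}_1$, all $\overline{p}_i\in\mathscr{S}_2$, all $q_i\in\mathscr{S}_3$, all $\overline{q}_i\in\mathscr{S}_4$, and $t_1,t_2,t_3,t_4$ are nonnegative integers such that every number of factors appearing in the form (namely $2t_1-1,\ 2t_2,\ t_3,\ 2t_4$ in (i), and $2t_1,\ 2t_2-1,\ t_3,\ 2t_4-1$ in (ii)) is nonnegative.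
   Context: For integers $a,b,c$ and $n$, $R(n,ax^2+bxy+cy^2)$ denotes the number of pairs $(x,y)\in\mathbb{Z}^2$ with $ax^2+bxy+cy^2=n$. The sets $\mathscr{S}_1,\dots,\mathscr{S}_4$ are the following sets of primes: $$\mathscr{S}_1=\{p \text{ prime}: p\equiv 11 \pmod{24},\ p=5x^2+2xy+11y^2 \text{ for some } x,y\in\mathbb{Z}\},$$ $$\mathscr{S}_2=\{p \text{ prime}: p\equiv 5 \pmod{24},\ p=5x^2+2xy+11y^2 \text{ for some } x,y\in\mathbb{Z}\},$$ $$\mathscr{S}_3=\{p \text{ prime}: p\equiv 1 \pmod{24},\ p=7x^2+6xy+9y^2 \text{ for some } x,y\in\mathbb{Z}\},$$ $$\mathscr{S}_4=\{p \text{ prime}: p\equiv 7 \pmod{24},\ p=7x^2+6xy+9y^2 \text{ for some } x,y\in\mathbb{Z}\}.$$ An empty list of factors contributes the empty product $1$. *)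

(* Defs.v *)
(* MathComp, with the classical sets of MathComp-Analysis. *)
From mathcomp Require Import all_boot all_order all_algebra finmap.
From mathcomp Require Import boolp classical_sets functions cardinality.
Set Implicit Arguments.
Unset Strict Implicit.
Unset Printing Implicit Defensive.
Import GRing.Theory.
Local Open Scope ring_scope.
Local Open Scope classical_set_scope.

Definition qform (a b c x y : int) : int :=
  a * x ^+ 2 + b * x * y + c * y ^+ 2.

(* [fset_set] returns the empty finite set on an infinite set, so this is the
   number of representations whenever that number is finite, in particular for
   every positive definite form. *)
Definition R (n a b c : int) : nat :=
  #|` fset_set [set z : int * int | qform a b c z.1 z.2 = n] |.

Definition squarefree (n : nat) : Prop :=
  forall d : nat, (d ^ 2 %| n)%N -> d = 1%N.

Definition S1 : set nat :=
  [set p | [/\ prime p, p = 11 %[mod 24]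
             & exists x y : int, p%:Z = qform 5 2 11 x y]].

Definition S2 : set nat :=
  [set p | [/\ prime p, p = 5 %[mod 24]
             & exists x y : int, p%:Z = qform 5 2 11 x y]].

Definition S3 : set nat :=
  [set p | [/\ prime p, p = 1 %[mod 24]
             & exists x y : int, p%:Z = qform 7 6 9 x y]].

Definition S4 : set nat :=
  [set p | [/\ prime p, p = 7 %[mod 24]
             & exists x y : int, p%:Z = qform 7 6 9 x y]].

(* [n] is a product of [k1], [k2], [k3], [k4] primes, not necessarily distinct,
   from [S1], [S2], [S3], [S4] respectively. *)
Definition factors_as (n k1 k2 k3 k4 : nat) : Prop :=
  exists (p : 'I_k1 -> nat) (pbar : 'I_k2 -> nat)
         (q : 'I_k3 -> nat) (qbar : 'I_k4 -> nat),
    [/\ forall i, S1 (p i), forall i, S2 (pbar i),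
        forall i, S3 (q i), forall i, S4 (qbar i)
      & n = ((\prod_(i < k1) p i) * (\prod_(i < k2) pbar i) *
             (\prod_(i < k3) q i) * (\prod_(i < k4) qbar i))%N].

(* Subtraction on [nat] is truncated: the inequalities [1 <= 2 * t] make each
   [2 * t - 1] the integer difference, and say that it is nonnegative. *)
Definition form_i (m : nat) : Prop :=
  exists t1 t2 t3 t4 : nat,
    (1 <= 2 * t1)%N /\
    factors_as m (2 * t1 - 1)%N (2 * t2)%N t3 (2 * t4)%N.

Definition form_ii (m : nat) : Prop :=
  exists t1 t2 t3 t4 : nat,
    [/\ (1 <= 2 * t2)%N, (1 <= 2 * t4)%N
      & factors_as m (2 * t1)%N (2 * t2 - 1)%N t3 (2 * t4 - 1)%N].

(* Main.v *)
Require Import Defs.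
From mathcomp Require Import all_boot all_order all_algebra finmap.
From mathcomp Require Import boolp classical_sets functions cardinality.
From mathcomp Require Import zify ring.
Set Implicit Arguments.
Unset Strict Implicit.
Unset Printing Implicit Defensive.
Import Order.TTheory GRing.Theory Num.Theory.

(** Since 2 (5x^2 + 2xy + 11y^2) = (2x + 4y)^2 + 6 (y - x)^2, the
    representations of m by the form of the theorem are the points (X, Y) with
    X^2 + 6Y^2 = 2m and X = Y mod 3 ([R_npts]): the form lives on a sublattice
    of index 3 of the maximal order Z[sqrt -6], whose class number is only 2.
    For X prime to 3, the residue t = Y/X mod 3 tells apart the three
    classes of a genus of discriminant -216, and it is additive: multiplying X + Y
    sqrt -6 by a + b sqrt -6 adds b/a to t.

    Let [rho t n] count the points of norm n or 2n with residue t, which treats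
    the two classes of Z[sqrt -6] together. If a prime p > 3 is such that p or
    2p is a^2 + 6b^2, and s = b/a mod 3, unique factorisation gives
    rho t (pn) = rho (t-s) n + rho (t+s) n for p not dividing n ([rho_mul]). If
    p is not of this kind, a squarefree multiple of p has no points at all
    ([inert_rho]); the class number enters here, through a pigeonhole argument
    ([prime_normP]). Remove the primes of m one at a time and look at rho 1
    modulo 4. If s = 0 the count rho 1 n, which is even, doubles, and becomes 0
    mod 4. If s is not 0, then rho 1 (pn) = rho 0 n + rho 1 n; the four sign
    changes act freely on the points of residue 0 when n > 1, so rho 1 keeps its
    value mod 4, while for n = 1 it jumps from 0 to 2 because of the points
    (1, 0) and (-1, 0). Hence rho 1 m = 2 mod 4 exactly when every prime factor
    of m has s different from 0 ([rho1_mod4]).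

    Those primes are exactly the members of S1, ..., S4: the genus of p is read
    off p mod 24, and s <> 0 rules out the ambiguous form of the genus
    ([shifting_eligible]). Finally, 5 and 11 generate a Klein four-group mod 24
    in which 7 = 5 * 11, so that m = 11 mod 24 only leaves two possible parity
    patterns for the numbers of factors, which are the two forms of the theorem
    ([forms_iff_eligible]). *)

(** * Counting points of norm N in a residue class modulo 3 *)

Section Counting.
Variable T : choiceType.
Local Open Scope classical_set_scope.

Lemma card_fset_image (T' : choiceType) (A : set T) (f : T -> T') :
  finite_set A -> (forall x y, A x -> A y -> f x = f y -> x = y) ->
  #|` fset_set (f @` A)| = #|` fset_set A|.
Proof.
move=> finA injf; rewrite fset_set_image // card_in_imfset //= => x y.
by rewrite !in_fset_set // !inE; apply: injf.
Qed.

Lemma card_fset_disjU (A B : set T) :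
  finite_set A -> finite_set B -> (forall x, A x -> B x -> False) ->
  #|` fset_set (A `|` B)| = #|` fset_set A| + #|` fset_set B|.
Proof.
move=> finA finB disjAB; rewrite fset_setU // -cardfsUI -fset_setI //.
suff -> : A `&` B = set0 by rewrite fset_set0 cardfs0 addn0.
by rewrite -subset0 => x [Ax Bx]; apply: (disjAB x).
Qed.

(** The tool for divisibility by 2 and 4: a sign change pairs the points where
    a coordinate is positive with those where it is negative. *)
Lemma card_fset_double (A P : set T) (f : T -> T) :
  finite_set A -> involutive f -> (forall x, A x -> A (f x)) ->
  (forall x, A x -> (P (f x) <-> ~ P x)) ->
  #|` fset_set A| = 2 * #|` fset_set (A `&` P)|.
Proof.
move=> finA fK fA fP; have finAP : finite_set (A `&` P) by apply: finite_setIl.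
have {1}-> : A = (A `&` P) `|` (f @` (A `&` P)).
  apply/seteqP; split=> [x Ax|x [[]//|[y [Ay _] <-]]]; last exact: fA.
  have [Px|nPx] := pselect (P x); first by left.
  by right; exists (f x) => //; split; [exact: fA | apply/fP].
rewrite card_fset_disjU //.
- rewrite card_fset_image ?mul2n ?addnn // => x y _ _.
  exact: (can_inj fK).
- exact: finite_image.
- move=> x [Ax Px] [y [Ay Py] fyx]; move: Px; rewrite -fyx.
  by move/(fP _ Ay).
Qed.

End Counting.

Section Lattice.
Local Open Scope classical_set_scope.
Local Open Scope ring_scope.

(** The second condition is Y = t X mod 3, written without an inverse of X; when
    3 does not divide N it forces X to be prime to 3, so t = Y/X mod 3. *)
Definition pts (t N : int) : set (int * int) :=
  [set z | z.1 ^+ 2 + 6 * z.2 ^+ 2 = N /\ (3 %| z.2 - t * z.1)%Z].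

Lemma finite_pts t N : finite_set (pts t N).
Proof.
pose K := `|N|%N; pose g (ij : 'I_(2 * K).+1 * 'I_(2 * K).+1) : int * int :=
  (ij.1%:Z - K%:Z, ij.2%:Z - K%:Z).
apply: (@sub_finite_set _ _ (g @` setT)); last exact/finite_image/finite_finset.
(* All coordinates lie between -K and K; shift them by K to index a finite box. *)
have small (u : int) : u ^+ 2 <= N -> (`|(u + K%:Z)%R| < (2 * K).+1)%N.
  by rewrite /K; nia.
have nonneg (u : int) : u ^+ 2 <= N -> 0 <= u + K%:Z.
  by rewrite /K; nia.
move=> [x y] [/= xyN _].
have [xN yN] : x ^+ 2 <= N /\ y ^+ 2 <= N by split; nia.
exists (Ordinal (small _ xN), Ordinal (small _ yN)) => //.
by rewrite /g /=; congr (_, _); [move: (nonneg _ xN)|move: (nonneg _ yN)]; lia.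
Qed.

Definition npts (t N : int) : nat := #|` fset_set (pts t N)|.

End Lattice.

(** * Multiplication by an element of norm p or 2p *)

Section Multiplication.
Local Open Scope classical_set_scope.
Local Open Scope ring_scope.

Lemma Euclid_dvdzM (p : nat) (x y : int) : prime p ->
  (p %| x * y)%Z = (p %| x)%Z || (p %| y)%Z.
Proof. by move=> pr_p; rewrite !dvdzE abszM /= Euclid_dvdM. Qed.

Lemma Euclid_dvdzX2 (p : nat) (x : int) : prime p ->
  (p %| x ^+ 2)%Z = (p %| x)%Z.
Proof. by move=> pr_p; rewrite expr2 Euclid_dvdzM // orbb. Qed.

Lemma prime_ndvd_small (p k : nat) : (0 < k < p)%N -> (p %| k%:Z)%Z = false.
Proof. by case/andP=> k0 kp; rewrite dvdzE /= gtnNdvd. Qed.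

Lemma dvdz_mul6 (p : nat) (x : int) : prime p -> (3 < p)%N ->
  (p %| 6 * x)%Z = (p %| x)%Z.
Proof.
move=> pr_p p3; have -> : 6 * x = 2%N%:Z * (3%N%:Z * x) by ring.
by rewrite !Euclid_dvdzM // !prime_ndvd_small //; lia.
Qed.

Lemma dvdz_norm (d x y : int) : (d %| x)%Z -> (d %| y)%Z ->
  (d * d %| x ^+ 2 + 6 * y ^+ 2)%Z.
Proof.
move=> /dvdzP[x' ->] /dvdzP[y' ->]; apply/dvdzP.
by exists (x' ^+ 2 + 6 * y' ^+ 2); ring.
Qed.

(** The product of a + b sqrt -6 and z.1 + z.2 sqrt -6. *)
Definition norm_mul (a b : int) (z : int * int) : int * int :=
  (a * z.1 - 6 * b * z.2, a * z.2 + b * z.1).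

Lemma norm_mul_inj a b : a ^+ 2 + 6 * b ^+ 2 != 0 -> injective (norm_mul a b).
Proof.
move=> q0 [x y] [x' y'] [e1 e2].
have ex : (a ^+ 2 + 6 * b ^+ 2) * x = (a ^+ 2 + 6 * b ^+ 2) * x'.
  transitivity (a * (a * x - 6 * b * y) + 6 * b * (a * y + b * x)); first ring.
  rewrite e1 e2; ring.
have ey : (a ^+ 2 + 6 * b ^+ 2) * y = (a ^+ 2 + 6 * b ^+ 2) * y'.
  transitivity (a * (a * y + b * x) - b * (a * x - 6 * b * y)); first ring.
  rewrite e1 e2; ring.
by rewrite (mulfI q0 ex) (mulfI q0 ey).
Qed.

(** The norm is multiplicative, and the residue of a product is the sum of the
    residues because the term 6 b z.2 vanishes modulo 3. *)
Lemma pts_norm_mul (a b s t q N : int) (z : int * int) :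
  q != 0 -> a ^+ 2 + 6 * b ^+ 2 = q -> ~~ (3 %| a)%Z -> (3 %| b - s * a)%Z ->
  pts t (q * N) (norm_mul a b z) <-> pts (t - s) N z.
Proof.
move=> q0 abq a3 bsa; case: z => [u v]; rewrite /pts /norm_mul /=.
have -> : (a * u - 6 * b * v) ^+ 2 + 6 * (a * v + b * u) ^+ 2
            = q * (u ^+ 2 + 6 * v ^+ 2) by rewrite -abq; ring.
have -> : (3 %| a * v + b * u - t * (a * u - 6 * b * v))%Z
            = (3 %| v - (t - s) * u)%Z.
  have -> : a * v + b * u - t * (a * u - 6 * b * v)
    = a * (v - (t - s) * u) + (u * (b - s * a) + 3 * (2 * t * b * v)) by ring.
  rewrite rpredDr; last by rewrite rpredD ?(dvdz_mull _ bsa) ?dvdz_mulr.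
  by rewrite (@Euclid_dvdzM 3) // (negbTE a3).
by split=> [[/(mulfI q0)]|[->]].
Qed.

(** The quotient of X + Y sqrt -6 by a + b sqrt -6 has coordinates
    (a X + 6 b Y) / q and (a Y - b X) / q. The second numerator is divisible by
    p as soon as the first is, by looking at the norm. When q = 2p, the numbers
    a and X are even (2 is ramified), so the factor 2 also divides out: this is
    why no case distinction on the parity of N occurs. *)
Lemma norm_mul_onto (p : nat) (a b X Y q N : int) : prime p -> (3 < p)%N ->
  q = p%:Z \/ q = 2 * p%:Z -> a ^+ 2 + 6 * b ^+ 2 = q ->
  X ^+ 2 + 6 * Y ^+ 2 = q * N -> (p %| a * X + 6 * b * Y)%Z ->
  exists z, norm_mul a b z = (X, Y).
Proof.
move=> pr_p p3 qE abq XYqN pu.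
have pq : (p %| q)%Z by case: qE => ->; rewrite ?dvdz_mull.
have q0 : q != 0 by case: qE => ->; lia.
have pv : (p %| a * Y - b * X)%Z.
  have : (p %| 6 * (a * Y - b * X) ^+ 2)%Z.
    have -> : 6 * (a * Y - b * X) ^+ 2
        = q * (q * N) - (a * X + 6 * b * Y) * (a * X + 6 * b * Y).
      by rewrite -XYqN -abq; ring.
    by rewrite rpredB ?dvdz_mulr.
  by rewrite dvdz_mul6 // Euclid_dvdzX2.
suff [/dvdzP[u uE] /dvdzP[v vE]] :
    (q %| a * X + 6 * b * Y)%Z /\ (q %| a * Y - b * X)%Z.
  exists (u, v); rewrite /norm_mul /=.
  congr (_, _); apply: (mulfI q0).
    transitivity (a * (u * q) - 6 * b * (v * q)); first by ring.
    by rewrite -uE -vE -abq; ring.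
  transitivity (a * (v * q) + b * (u * q)); first by ring.
  by rewrite -uE -vE -abq; ring.
case: qE => qE; rewrite qE //.
have even_sq (w : int) : (2 %| w ^+ 2)%Z -> (2 %| w)%Z by rewrite (@Euclid_dvdzX2 2).
have /dvdzP[a' aE] : (2 %| a)%Z by apply: even_sq; lia.
have /dvdzP[X' XE] : (2 %| X)%Z.
  apply: even_sq.
  have -> : X ^+ 2 = 2 * (p%:Z * N - 3 * Y ^+ 2) by rewrite qE in XYqN; lia.
  exact: dvdz_mulr.
have co2p : coprimez 2 p%:Z.
  by rewrite coprimezE /= prime_coprime // dvdn_prime2 //; lia.
split; rewrite Gauss_dvdz // ?pu ?pv andbT aE XE.
  have -> : a' * 2 * (X' * 2) + 6 * b * Y = 2 * (2 * a' * X' + 3 * b * Y) by ring.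
  exact: dvdz_mulr.
have -> : a' * 2 * Y - b * (X' * 2) = 2 * (a' * Y - b * X') by ring.
exact: dvdz_mulr.
Qed.

(** Each point of norm q N is divisible by a + b sqrt -6 or by its conjugate, as
    p divides (a X + 6 b Y) (a X - 6 b Y); never by both, since otherwise p would
    divide X and Y, and p^2 the norm. The two summands count the two kinds of
    points. *)
Lemma npts_mul (p : nat) (a b s t q N : int) : prime p -> (3 < p)%N ->
  q = p%:Z \/ q = 2 * p%:Z -> a ^+ 2 + 6 * b ^+ 2 = q -> (3 %| b - s * a)%Z ->
  ~~ (p %| N)%Z ->
  npts t (q * N) = (npts (t - s) N + npts (t + s) N)%N.
Proof.
move=> pr_p p3 qE abq bsa pN.
have q0 : q != 0 by case: qE => ->; lia.
have pq : (p %| q)%Z by case: qE => ->; rewrite ?dvdz_mull.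
have abq' : a ^+ 2 + 6 * (- b) ^+ 2 = q by rewrite sqrrN.
have a3 : ~~ (3 %| a)%Z.
  apply/negP => /dvdzP[k ak]; have : (3 %| q)%Z.
    by rewrite -abq ak; apply/dvdzP; exists (3 * k ^+ 2 + 2 * b ^+ 2); ring.
  have p3' : (3 %| p%:Z)%Z = false by rewrite dvdzE /= dvdn_prime2 //; lia.
  by case: qE => ->; rewrite ?(@Euclid_dvdzM 3) ?p3' ?orbF.
have bsa' : (3 %| - b - - s * a)%Z.
  have -> : - b - - s * a = - (b - s * a) by ring.
  by rewrite rpredN.
have two : (p %| 2)%Z = false by apply: prime_ndvd_small; lia.
have pp (x : int) : (p%:Z * p%:Z %| q * x)%Z -> (p %| x)%Z.
  have p0 : p%:Z != 0 by lia.
  case: qE => ->; first by rewrite dvdz_mul2l.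
  by rewrite -mulrA mulrCA dvdz_mul2l ?Euclid_dvdzM ?two.
have pa : ~~ (p %| a)%Z.
  apply/negP => pa; have pb : (p %| b)%Z.
    rewrite -Euclid_dvdzX2 // -(dvdz_mul6 _ pr_p p3) (_ : 6 * b ^+ 2 = q - a * a);
      last by rewrite -abq; ring.
    by rewrite rpredB // dvdz_mulr.
  have : (p %| 1)%Z.
    by apply: pp; rewrite mulr1 -abq; apply: dvdz_norm.
  by rewrite prime_ndvd_small //; lia.
rewrite /npts; have -> : pts t (q * N) = norm_mul a b @` pts (t - s) N
                           `|` norm_mul a (- b) @` pts (t + s) N.
  apply/seteqP; split=> [[X Y] XYpts|_ [[z zpts <-]|[z zpts <-]]].
  - have [/= XYqN _] := XYpts.
    have : (p %| (a * X + 6 * b * Y) * (a * X + 6 * - b * Y))%Z.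
      have -> : (a * X + 6 * b * Y) * (a * X + 6 * - b * Y)
          = q * (a ^+ 2 * N - 6 * Y ^+ 2).
        transitivity (a ^+ 2 * (X ^+ 2 + 6 * Y ^+ 2) - q * (6 * Y ^+ 2)).
          by rewrite -abq; ring.
        by rewrite XYqN; ring.
      exact: dvdz_mulr.
    rewrite Euclid_dvdzM // => /orP[pu|pu]; [left|right].
      have [z zE] := norm_mul_onto pr_p p3 qE abq XYqN pu.
      exists z => //; apply/(pts_norm_mul _ _ _ q0 abq a3 bsa).
      by rewrite zE.
    have [z zE] := norm_mul_onto pr_p p3 qE abq' XYqN pu.
    exists z => //; rewrite -[s]opprK.
    by apply/(pts_norm_mul _ _ _ q0 abq' a3 bsa'); rewrite zE.
  - exact/(pts_norm_mul _ _ _ q0 abq a3 bsa).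
  - by apply/(pts_norm_mul _ _ _ q0 abq' a3 bsa'); rewrite opprK.
rewrite card_fset_disjU; try exact/finite_image/finite_pts.
- by rewrite !card_fset_image //; try exact: finite_pts;
    move=> x y _ _; apply: norm_mul_inj; rewrite ?abq ?abq'.
- move=> _ [[u v] [/= uvN _] <-] [[u' v'] _ [e1 e2]].
  set X := a * u - 6 * b * v in e1; set Y := a * v + b * u in e2.
  have XYqN : X ^+ 2 + 6 * Y ^+ 2 = q * N by rewrite -uvN -abq /X /Y; ring.
  have pX : (p %| X)%Z.
    have : (p %| 2 * (a * X))%Z.
      have -> : 2 * (a * X) = q * (u + u').
        transitivity (a * X + 6 * b * Y + (a * X - 6 * b * Y)); first by ring.
        rewrite {1}/X {1}/Y -e1 -e2 -abq; ring.
      exact: dvdz_mulr.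
    by rewrite !Euclid_dvdzM // two (negbTE pa).
  have pY : (p %| Y)%Z.
    rewrite -Euclid_dvdzX2 // -(dvdz_mul6 _ pr_p p3) (_ : 6 * Y ^+ 2 = q * N - X * X);
      last by rewrite -XYqN; ring.
    by rewrite rpredB // dvdz_mulr.
  move/negP: pN; apply; apply: pp.
  by rewrite -XYqN; apply: dvdz_norm.
Qed.

End Multiplication.

(** * Counting norms n and 2n together *)

Section Genus.
Local Open Scope classical_set_scope.
Local Open Scope ring_scope.

(** A point of norm divisible by 4 has even coordinates. Together with
    [npts_mul] this handles the product of two elements of norms 2p and 2n. *)
Lemma npts_mul4 t N : npts t (4 * N) = npts t N.
Proof.
have even_sq (w : int) : (2 %| w ^+ 2)%Z -> (2 %| w)%Z.
  by rewrite (@Euclid_dvdzX2 2).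
rewrite /npts -(card_fset_image (A := pts t N) (f := fun z => (2 * z.1, 2 * z.2))).
- congr #|` fset_set _|; apply/seteqP; split=> [[X Y] [/= XYN tXY]|_ [[u v] [/= uvN tuv] <-]].
    have /dvdzP[u uE] : (2 %| X)%Z.
      apply: even_sq; apply/dvdzP; exists (2 * N - 3 * Y ^+ 2); lia.
    have /dvdzP[v vE] : (2 %| Y)%Z.
      apply: even_sq; apply/dvdzP; exists (N - u ^+ 2 - Y ^+ 2).
      move: XYN; rewrite uE; lia.
    exists (u, v); last by rewrite /= uE vE !(mulrC 2).
    split=> /=; first by move: XYN; rewrite uE vE; lia.
    move: tXY; rewrite uE vE.
    have -> : v * 2 - t * (u * 2) = 2%N%:Z * (v - t * u) by ring.
    by rewrite (@Euclid_dvdzM 3).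
  split=> /=; first by rewrite -uvN; ring.
  have -> : 2 * v - t * (2 * u) = 2 * (v - t * u) by ring.
  exact: dvdz_mull.
- exact: finite_pts.
- by move=> [x y] [x' y'] _ _ [ex ey]; congr (_, _); lia.
Qed.

(** Conjugation exchanges the residues 1 and 2 = -1. *)
Lemma npts2_1 N : npts 2 N = npts 1 N.
Proof.
rewrite /npts -(card_fset_image (A := pts 1 N) (f := fun z => (z.1, - z.2))).
- congr #|` fset_set _|; apply/seteqP; split=> [[X Y] [/= XYN tXY]|_ [[u v] [/= uvN tuv] <-]].
    exists (X, - Y); last by rewrite /= opprK.
    split=> /=; first by rewrite sqrrN.
    lia.
  split=> /=; first by rewrite sqrrN.
  lia.
- exact: finite_pts.
- by move=> [x y] [x' y'] _ _ [ex ey]; congr (_, _); lia.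
Qed.

Lemma npts_even t N : ~~ (3 %| N)%Z -> (2 %| npts t N)%N.
Proof.
move=> N3; rewrite /npts (@card_fset_double _ _ [set z | 0 < z.1] (fun z => (- z.1, - z.2))).
- exact: dvdn_mulr.
- exact: finite_pts.
- by move=> [x y] /=; rewrite !opprK.
- move=> [x y] [/= xyN xyt]; split=> /=; first by rewrite !sqrrN.
  have -> : - y - t * - x = - (y - t * x) by ring.
  by rewrite rpredN.
- move=> [x y] [/= xyN _]; split=> //=; first lia.
  have : x <> 0 by move=> x0; move: xyN N3; rewrite x0; lia.
  lia.
Qed.

(** The sign changes of X and of Y both preserve the residue 0, and act freely
    because no point lies on an axis: X = 0 would make 3 divide N, and Y = 0
    would make N a square. *)
Lemma npts0_dvd4 N : ~~ (3 %| N)%Z -> (forall x : int, x ^+ 2 <> N) ->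
  (4 %| npts 0 N)%N.
Proof.
move=> N3 Nsq; rewrite /npts (@card_fset_double _ _ [set z | 0 < z.1] (fun z => (- z.1, z.2))).
- rewrite (@card_fset_double _ _ [set z | 0 < z.2] (fun z => (z.1, - z.2))).
  + by rewrite mulnA dvdn_mulr.
  + exact/finite_setIl/finite_pts.
  + by move=> [x y] /=; rewrite !opprK.
  + move=> [x y] [[/= xyN xyt] x0]; split=> //; split=> /=; first by rewrite !sqrrN.
    by lia.
  + move=> [x y] [[/= xyN _] _]; split=> //=; first lia.
    have : y <> 0 by move=> y0; apply: (Nsq x); move: xyN; rewrite y0; lia.
    lia.
- exact: finite_pts.
- by move=> [x y] /=; rewrite !opprK.
- move=> [x y] [/= xyN xyt]; split=> /=; first by rewrite !sqrrN.
  by lia.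
- move=> [x y] [/= xyN _]; split=> //=; first lia.
  have : x <> 0 by move=> x0; move: xyN N3; rewrite x0; lia.
  lia.
Qed.

Lemma npts_eq0 t N : (forall x y : int, x ^+ 2 + 6 * y ^+ 2 <> N) -> npts t N = 0%N.
Proof.
move=> noN; rewrite /npts (_ : pts t N = set0) ?fset_set0 ?cardfs0 //.
by rewrite -subset0 => -[x y] [/= /noN].
Qed.

(** The ideals of norm n in Z[sqrt -6] that are principal correspond to points of
    norm n; the others become principal after multiplication by the prime above
    2, and correspond to points of norm 2n. For n prime to 3 at most one of the
    two terms is nonzero. *)
Definition rho (t : int) (n : nat) : nat := (npts t n%:Z + npts t (2 * n%:Z))%N.

(** When 2p is a norm, multiplication exchanges the two terms of [rho], with
    [npts_mul4] to come back from 4pn to pn. *)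
Lemma rho_mul (p n : nat) (a b s t : int) : prime p -> (3 < p)%N -> ~~ (p %| n)%N ->
  a ^+ 2 + 6 * b ^+ 2 = p%:Z \/ a ^+ 2 + 6 * b ^+ 2 = 2 * p%:Z ->
  (3 %| b - s * a)%Z ->
  rho t (p * n) = (rho (t - s) n + rho (t + s) n)%N.
Proof.
move=> pr_p p3 pn qE bsa.
have pn1 : ~~ (p %| n%:Z)%Z by [].
have pn2 : ~~ (p %| 2 * n%:Z)%Z by rewrite Euclid_dvdzM // (@prime_ndvd_small p 2) //; lia.
have mul q (qE' : q = p%:Z \/ q = 2 * p%:Z) (abq : a ^+ 2 + 6 * b ^+ 2 = q) :
    (npts t (q * n%:Z) + npts t (q * (2 * n%:Z)))%N = (rho (t - s) n + rho (t + s) n)%N.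
  rewrite (npts_mul t pr_p p3 qE' abq bsa pn1) (npts_mul t pr_p p3 qE' abq bsa pn2).
  by rewrite addnACA.
case: qE => abq.
  rewrite -(mul _ _ abq); last by left.
  by rewrite /rho PoszM mulrCA.
rewrite -(mul _ _ abq); last by right.
rewrite /rho PoszM addnC -(npts_mul4 t (p%:Z * n%:Z)).
by congr (npts _ _ + npts _ _)%N; ring.
Qed.

Lemma rho2_1 n : rho 2 n = rho 1 n.
Proof. by rewrite /rho !npts2_1. Qed.

Lemma rho_even t n : ~~ (3 %| n)%N -> (2 %| rho t n)%N.
Proof. by move=> n3; rewrite dvdn_add // npts_even //; lia. Qed.

Lemma rho0_dvd4 n : squarefree n -> (1 < n)%N -> ~~ (2 %| n)%N -> ~~ (3 %| n)%N ->
  (4 %| rho 0 n)%N.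
Proof.
move=> sqf n1 n2 n3; rewrite dvdn_add //; apply: npts0_dvd4 => [|x xn]; try lia.
  have /sqf x1 : (`|x| ^ 2 %| n)%N by rewrite -abszX xn.
  have : `|x ^+ 2|%N = 1%N by rewrite abszX x1.
  by rewrite xn /=; lia.
have /dvdzP[y yE] : (2 %| x)%Z by rewrite -(@Euclid_dvdzX2 2) // xn dvdz_mulr.
by move: xn; rewrite yE; lia.
Qed.

Lemma norm_lt3 (x y : int) : x ^+ 2 + 6 * y ^+ 2 < 3 ->
  y = 0 /\ [\/ x = 0, x = 1 | x = -1].
Proof.
move=> lt3; have y0 : y = 0 by nia.
split=> //; move: lt3; rewrite y0 => lt3.
have xlt2 : x < 2 by nia.
have xgtN2 : -2 < x by nia.
have : x = 0 \/ x = 1 \/ x = -1 by lia.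
by case=> [|[]]; [constructor 1|constructor 2|constructor 3].
Qed.

Lemma npts_2 t : npts t 2 = 0%N.
Proof.
apply: npts_eq0 => x y xy2; have [] : y = 0 /\ [\/ x = 0, x = 1 | x = -1].
  by apply: norm_lt3; rewrite xy2.
by move=> y0 [] x0; move: xy2; rewrite x0 y0.
Qed.

Lemma pts_1 : [set z : int * int | z.1 ^+ 2 + 6 * z.2 ^+ 2 = 1] = [set (1, 0); (-1, 0)].
Proof.
apply/seteqP; split=> [[x y] /= xy1|_ [] -> //].
have [] : y = 0 /\ [\/ x = 0, x = 1 | x = -1] by apply: norm_lt3; rewrite xy1.
by move=> y0 [] x0; move: xy1; rewrite x0 y0 //; [left|right].
Qed.

Lemma rho1_1 : rho 1 1 = 0%N.
Proof.
rewrite /rho npts_2 addn0 /npts (_ : pts 1 _ = set0) ?fset_set0 ?cardfs0 //.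
rewrite -subset0 => z [zN]; have : [set (1, 0); (-1, 0)] z by rewrite -pts_1.
by case=> ->.
Qed.

Lemma rho0_1 : rho 0 1 = 2%N.
Proof.
rewrite /rho npts_2 addn0 /npts (_ : pts 0 _ = [set (1, 0); (-1, 0)]).
  by rewrite fset_setU // !fset_set1 cardfs2.
rewrite -pts_1; apply/seteqP; split=> [z []//|z zN]; split=> //.
have : [set (1, 0); (-1, 0)] z by rewrite -pts_1.
by case=> ->.
Qed.

End Genus.

(** * Which primes are norms up to a factor 2 *)

Section Thue.
Local Open Scope ring_scope.

Lemma sqrtn_bounds (n : nat) : exists s, (s ^ 2 <= n < s.+1 ^ 2)%N.
Proof.
elim: n => [|n [s /andP[sn ns]]]; first by exists 0%N.
have [ns'|ns'] := ltnP n.+1 (s.+1 ^ 2); first by exists s; rewrite ns' leqW.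
by exists s.+1; rewrite ns' /=; move: ns; rewrite -!mulnn; lia.
Qed.

(** Pigeonhole: the (s+1)^2 > p numbers i B + j A with 0 <= i, j <= s cannot be
    distinct modulo p, where s is the integer part of the square root of p. *)
Lemma thue (p A B : nat) : prime p ->
  exists u v : int, [/\ (u != 0) || (v != 0), u ^+ 2 < p%:Z, v ^+ 2 < p%:Z
                      & (p %| u * B%:Z - v * A%:Z)%Z].
Proof.
move=> pr_p; have p0 := prime_gt0 pr_p.
have [s /andP[sp ps]] := sqrtn_bounds p.
have ltsp : (s ^ 2 < p)%N.
  rewrite ltn_neqAle sp andbT; apply/eqP => spE.
  move: pr_p; rewrite -spE => pr_s; have /(prime_nt_dvdP pr_s) : (s %| s ^ 2)%N by rewrite dvdn_exp.
  by case: s {sp ps spE} pr_s => [|[|s]] // _ /(_ isT); nia.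
pose f (ij : 'I_s.+1 * 'I_s.+1) := Ordinal (ltn_pmod (ij.1 * B + ij.2 * A) p0).
have /injectivePn[[i j] [[i' j'] neq /(congr1 val) /= fE]] : ~~ injectiveb f.
  apply/negP => /injectiveP /leq_card; rewrite card_prod !card_ord; move: ps; lia.
exists (i%:Z - i'%:Z), (j'%:Z - j%:Z); split.
- move: neq; rewrite xpair_eqE negb_and -!(inj_eq val_inj) /=; lia.
- by have := ltn_ord i; have := ltn_ord i'; move: ltsp; rewrite -mulnn; nia.
- by have := ltn_ord j; have := ltn_ord j'; move: ltsp; rewrite -mulnn; nia.
- have : (p%:Z %| (i * B + j * A)%N%:Z - (i' * B + j' * A)%N%:Z)%Z.
    by rewrite -eqz_mod_dvd !modz_nat fE.
  by congr (_ %| _)%Z; lia.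
Qed.

(** Thue's lemma gives a norm k p with 0 < k < 7. The ramified primes 2 and 3 can
    be divided out of k, which leaves p or 2p; for k = 5, multiplying by an
    element 2 + sqrt -6 or 2 - sqrt -6, of norm 10, and dividing by 5 gives 2p.
    This replaces the computation of the class group of Z[sqrt -6]. *)
Lemma prime_normP (p : nat) (X Y : int) : prime p -> (3 < p)%N ->
  (p %| X ^+ 2 + 6 * Y ^+ 2)%Z -> ~~ (p %| Y)%Z ->
  exists a b : int, a ^+ 2 + 6 * b ^+ 2 = p%:Z \/ a ^+ 2 + 6 * b ^+ 2 = 2 * p%:Z.
Proof.
move=> pr_p p3 pXY pY.
have [u [v [uv0 up vp puv]]] := thue `|X| `|Y| pr_p.
have puv2 : (p %| u ^+ 2 + 6 * v ^+ 2)%Z.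
  have : (p %| Y ^+ 2 * (u ^+ 2 + 6 * v ^+ 2))%Z.
    have -> : Y ^+ 2 * (u ^+ 2 + 6 * v ^+ 2) =
        (u * `|Y|%N%:Z - v * `|X|%N%:Z) * (u * `|Y|%N%:Z + v * `|X|%N%:Z)
        + v ^+ 2 * (X ^+ 2 + 6 * Y ^+ 2).
      have -> : X ^+ 2 = `|X|%N%:Z ^+ 2 by rewrite abszE real_normK ?num_real.
      have -> : Y ^+ 2 = `|Y|%N%:Z ^+ 2 by rewrite abszE real_normK ?num_real.
      ring.
    by apply: rpredD; [apply: dvdz_mulr | apply: dvdz_mull].
  by rewrite Euclid_dvdzM // Euclid_dvdzX2 // (negbTE pY).
have /dvdzP[k kE] := puv2; clear pXY pY puv puv2.
have p0 : 0 < p%:Z by lia.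
have k0 : 0 < k.
  have [u2 v2] : 0 <= u ^+ 2 /\ 0 <= 6 * v ^+ 2.
    by split; [exact: sqr_ge0 | apply: mulr_ge0 => //; exact: sqr_ge0].
  rewrite -(pmulr_lgt0 _ p0) -kE lt0r (addr_ge0 u2 v2) andbT (paddr_eq0 u2 v2).
  by rewrite !mulf_eq0 /= !orbb negb_and.
have k7 : k < 7 by rewrite -(ltr_pM2r p0) -kE; move: up vp; clear; lia.
have : k = 1 \/ k = 2 \/ k = 3 \/ k = 4 \/ k = 5 \/ k = 6 by move: k0 k7; clear; lia.
have even_sq (w : int) : (2 %| w ^+ 2)%Z -> (2 %| w)%Z by rewrite (@Euclid_dvdzX2 2).
have mul3_sq (w : int) : (3 %| w ^+ 2)%Z -> (3 %| w)%Z by rewrite (@Euclid_dvdzX2 3).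
case=> [|[|[|[|[|]]]]] kk; rewrite {k k0 k7}kk in kE.
- by exists u, v; left; lia.
- by exists u, v; right; lia.
- have /dvdzP[w wE] : (3 %| u)%Z by apply: mul3_sq; lia.
  by exists (2 * v), w; right; rewrite wE in kE; lia.
- have /dvdzP[w wE] : (2 %| u)%Z by apply: even_sq; lia.
  have /dvdzP[z zE] : (2 %| v)%Z by apply: even_sq; rewrite wE in kE; lia.
  by exists w, z; left; rewrite wE zE in kE; lia.
- have : (5 %| (u - 2 * v) * (u + 2 * v))%Z.
    have -> : (u - 2 * v) * (u + 2 * v) = 5 * (p%:Z - 2 * v ^+ 2) by lia.
    exact: dvdz_mulr.
  rewrite (@Euclid_dvdzM 5) // => /orP[] /dvdzP[w wE].
    have uE : u = w * 5 + 2 * v by lia.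
    by exists (2 * (w + v)), w; right; rewrite uE in kE; lia.
  have uE : u = w * 5 - 2 * v by lia.
  by exists (2 * (w - v)), w; right; rewrite uE in kE; lia.
- have /dvdzP[w wE] : (2 %| u)%Z by apply: even_sq; lia.
  have /dvdzP[z zE] : (3 %| w)%Z by apply: mul3_sq; rewrite wE in kE; lia.
  by exists v, z; left; rewrite wE zE in kE; lia.
Qed.

End Thue.

(** * The count modulo 4 *)

Section Parity.
Local Open Scope ring_scope.

(** The primes p such that multiplication by an element of norm p or 2p shifts
    the residue Y/X mod 3, i.e. the primes whose class in the order of conductor
    3 is not killed by 2. *)
Definition shifting (p : nat) : Prop := exists a b : int,
  (a ^+ 2 + 6 * b ^+ 2 = p%:Z \/ a ^+ 2 + 6 * b ^+ 2 = 2 * p%:Z) /\ ~~ (3 %| b)%Z.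

Lemma prime_gt3_ndvd3 (p : nat) : prime p -> (3 < p)%N -> ~~ (3 %| p)%N.
Proof. by move=> pr_p p3; rewrite dvdn_prime2 // neq_ltn p3. Qed.

(** Changing the sign of a normalises the shift b/a to 1. *)
Lemma shifting_aligned p : prime p -> (3 < p)%N -> shifting p ->
  exists a b : int, [/\ a ^+ 2 + 6 * b ^+ 2 = p%:Z \/ a ^+ 2 + 6 * b ^+ 2 = 2 * p%:Z,
    ~~ (3 %| b)%Z & (3 %| b - a)%Z].
Proof.
move=> pr_p p3 [a [b [abp b3]]]; have p3' := prime_gt3_ndvd3 pr_p p3.
have a3 : ~~ (3 %| a)%Z.
  apply/negP => /dvdzP[k kE]; rewrite kE in abp; case: abp; lia.
have [ba|ba] := boolP (3 %| b - a)%Z; first by exists a, b.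
by exists (- a), b; split=> //; [rewrite sqrrN | lia].
Qed.

Lemma shifting_rho p n : prime p -> (3 < p)%N -> ~~ (p %| n)%N -> shifting p ->
  rho 1 (p * n) = (rho 0 n + rho 1 n)%N.
Proof.
move=> pr_p p3 pn /(shifting_aligned pr_p p3)[a [b [abp _ ba]]].
rewrite (@rho_mul p n a b 1 1 pr_p p3 pn abp) ?mul1r // subrr.
by rewrite -rho2_1.
Qed.

Lemma nonshifting_rho p n (a b : int) : prime p -> (3 < p)%N -> ~~ (p %| n)%N ->
  a ^+ 2 + 6 * b ^+ 2 = p%:Z \/ a ^+ 2 + 6 * b ^+ 2 = 2 * p%:Z -> (3 %| b)%Z ->
  rho 1 (p * n) = (2 * rho 1 n)%N.
Proof.
move=> pr_p p3 pn abp b3.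
by rewrite (@rho_mul p n a b 0 1 pr_p p3 pn abp) ?mul0r ?subr0 ?addr0 // mul2n addnn.
Qed.

(** The shift does not depend on the element of norm p or 2p chosen: it is seen
    in the value of [rho 1 p], which is 0 or 2. *)
Lemma nonshifting_prime p (a b : int) : prime p -> (3 < p)%N ->
  a ^+ 2 + 6 * b ^+ 2 = p%:Z \/ a ^+ 2 + 6 * b ^+ 2 = 2 * p%:Z -> (3 %| b)%Z ->
  ~ shifting p.
Proof.
move=> pr_p p3 abp b3 shp.
have p1 : ~~ (p %| 1)%N by rewrite dvdn1; lia.
have := nonshifting_rho pr_p p3 p1 abp b3.
by rewrite shifting_rho // rho0_1 rho1_1.
Qed.

(** If p divides a norm X^2 + 6Y^2 exactly once, then it does not divide Y, and p
    or 2p is itself a norm. *)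
Lemma inert_rho p n t : prime p -> (3 < p)%N -> ~~ (p %| n)%N ->
  ~ (exists a b : int, a ^+ 2 + 6 * b ^+ 2 = p%:Z \/ a ^+ 2 + 6 * b ^+ 2 = 2 * p%:Z) ->
  rho t (p * n) = 0%N.
Proof.
move=> pr_p p3 pn norep.
have p0 : p%:Z != 0 by lia.
have no_norm N : ~~ (p %| N)%Z -> npts t (p%:Z * N) = 0%N.
  move=> pN; apply: npts_eq0 => x y xyN; apply: norep.
  have pxy : (p %| x ^+ 2 + 6 * y ^+ 2)%Z by rewrite xyN dvdz_mulr.
  apply: (prime_normP pr_p p3 pxy); apply/negP => py; case/negP: pN.
  have px : (p %| x)%Z.
    rewrite -Euclid_dvdzX2 // -[_ ^+ 2](addrK (6 * y ^+ 2)).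
    by rewrite rpredB // dvdz_mull // Euclid_dvdzX2.
  by rewrite -(@dvdz_mul2l p%:Z) // -xyN dvdz_norm.
rewrite /rho PoszM mulrCA !no_norm //.
by rewrite Euclid_dvdzM // (@prime_ndvd_small p 2) //; lia.
Qed.

Lemma squarefree_dvd d n : (d %| n)%N -> squarefree n -> squarefree d.
Proof. by move=> dn sqf e ed; apply: sqf; apply: dvdn_trans dn. Qed.

Lemma squarefree_coprime p n : (1 < p)%N -> squarefree (p * n) -> ~~ (p %| n)%N.
Proof.
move=> p1 sqf; apply/negP => pn; have p_eq1 : p = 1%N.
  by apply: sqf; rewrite -mulnn dvdn_mul.
by rewrite p_eq1 in p1.
Qed.

(** Induction on m, removing its least prime factor p. *)
Lemma rho1_mod4 (m : nat) : squarefree m -> (1 < m)%N -> ~~ (2 %| m)%N -> ~~ (3 %| m)%N ->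
  rho 1 m = 2 %[mod 4] <-> (forall p, prime p -> (p %| m)%N -> shifting p).
Proof.
have [k] := ubnP m; elim: k m => // k IHk m mk sqf m1 m2 m3.
have pr_p := pdiv_prime m1; have pm := pdiv_dvd m.
move: (pdiv m) pr_p pm => p pr_p /dvdnP[n nE].
rewrite mulnC in nE; rewrite nE in mk sqf m1 m2 m3 *.
have p3 : (3 < p)%N.
  have p_neq (q : nat) : ~~ (q %| p * n)%N -> p != q.
    by apply: contraNneq => <-; apply: dvdn_mulr.
  by have := prime_gt1 pr_p; move: (p_neq _ m2) (p_neq _ m3); lia.
have pn := squarefree_coprime (prime_gt1 pr_p) sqf.
have n2 : ~~ (2 %| n)%N by apply: contra m2; apply: dvdn_mull.
have n3 : ~~ (3 %| n)%N by apply: contra m3; apply: dvdn_mull.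
have sqfn : squarefree n by apply: squarefree_dvd sqf; apply: dvdn_mull.
have [[a [b abp]]|norep] := pselect (exists a b : int,
    a ^+ 2 + 6 * b ^+ 2 = p%:Z \/ a ^+ 2 + 6 * b ^+ 2 = 2 * p%:Z); last first.
  rewrite inert_rho //; split=> // shall; case: norep.
  have [a [b [abp _]]] := shall p pr_p (dvdn_mulr n (dvdnn p)).
  by exists a, b.
have [b3|b3] := boolP (3 %| b)%Z.
  rewrite (nonshifting_rho pr_p p3 pn abp b3); split=> [|shall].
    by have := rho_even 1 n3; lia.
  by case: (nonshifting_prime pr_p p3 abp b3); apply: shall; rewrite // dvdn_mulr.
have shp : shifting p by exists a, b.
rewrite shifting_rho //.
have [n1|n1] := eqVneq n 1%N.
  rewrite n1 muln1 rho0_1 rho1_1; split=> // _ q pr_q.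
  by rewrite dvdn_prime2 // => /eqP ->.
have {}n1 : (1 < n)%N by move: n1 n2; case: (n) => [|[]].
have nk : (n < k)%N.
  by apply: leq_trans (_ : (p * n <= k)%N); [rewrite ltn_Pmull //; lia | lia].
have r4 : (4 %| rho 0 n)%N := rho0_dvd4 sqfn n1 n2 n3.
have -> : (rho 0 n + rho 1 n = 2 %[mod 4]) <-> (rho 1 n = 2 %[mod 4]).
  by rewrite -modnDml (eqP r4) add0n.
rewrite (IHk n nk sqfn n1 n2 n3); split=> shall q pr_q qm.
  by move: qm; rewrite Euclid_dvdM // dvdn_prime2 // => /orP[/eqP -> //|]; apply: shall.
by apply: shall; rewrite // dvdn_mull.
Qed.

End Parity.

(** * From quadratic forms to norms *)

Section Forms.
Local Open Scope classical_set_scope.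
Local Open Scope ring_scope.

(** The change of variables (x, y) -> (2x + 4y, y - x), with inverse [g]. *)
Lemma R_npts N : R N 5 2 11 = npts 1 (2 * N).
Proof.
pose g (z : int * int) : int * int :=
  (((z.1 + 2 * z.2) %/ 6)%Z - z.2, ((z.1 + 2 * z.2) %/ 6)%Z).
have gE (x y : int) : g (2 * x + 4 * y, y - x) = (x, y).
  rewrite /g /=; have -> : 2 * x + 4 * y + 2 * (y - x) = y * 6 by ring.
  by rewrite mulzK //; congr (_, _); ring.
have onto u v : pts 1 (2 * N) (u, v) ->
    exists x y, (u, v) = (2 * x + 4 * y, y - x).
  move=> [/= uvN uv3]; have /dvdzP[k kE] : (2 %| u)%Z.
    by rewrite -(@Euclid_dvdzX2 2) //; apply/dvdzP; exists (N - 3 * v ^+ 2); lia.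
  have /dvdzP[j jE] := uv3.
  by exists (- k - 2 * j), (k + j); congr (_, _); lia.
rewrite /R /npts -(card_fset_image (A := pts 1 (2 * N)) (f := g)).
- congr #|` fset_set _|; apply/seteqP; split=> [[x y] /= xyN|_ [[u v] uvpts <-]].
    exists (2 * x + 4 * y, y - x); last exact: gE.
    split=> /=; first by rewrite -xyN /qform; ring.
    lia.
  have [x [y uvE]] := onto _ _ uvpts; rewrite uvE gE /=.
  apply: (@mulfI _ 2) => //; move: uvpts; rewrite uvE => -[/= <- _].
  by rewrite /qform; ring.
- exact: finite_pts.
- move=> [u v] [u' v'] /onto[x [y ->]] /onto[x' [y' ->]].
  by rewrite !gE => -[-> ->].
Qed.

(** The points of norm m do not contribute to [rho]: X^2 is never 2 mod 3. *)
Lemma rho_R (m : nat) : m = 2 %[mod 3] -> rho 1 m = R m%:Z 5 2 11.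
Proof.
move=> m3; rewrite R_npts /rho npts_eq0 // => x y xym.
have sq3 : (x ^+ 2 %% 3)%Z = 0 \/ (x ^+ 2 %% 3)%Z = 1.
  have [k [|[|]] xE] : exists k, x = 3 * k \/ x = 3 * k + 1 \/ x = 3 * k - 1.
  - by exists ((x + 1) %/ 3)%Z; lia.
  - by left; rewrite xE; lia.
  - by right; rewrite xE; lia.
  - by right; rewrite xE; lia.
by case: sq3; lia.
Qed.

Definition eligible (p : nat) : Prop := [\/ S1 p, S2 p, S3 p | S4 p].

Lemma eligible_prime p : eligible p -> prime p.
Proof. by case=> -[]. Qed.

(** The forms are 2 (5x^2 + 2xy + 11y^2) = (2x + 4y)^2 + 6 (y - x)^2 and
    7x^2 + 6xy + 9y^2 = (x + 3y)^2 + 6x^2. If 3 divided the second coordinate, it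
    would divide the first as well, and then p. *)
Lemma eligible_shifting p : eligible p -> shifting p.
Proof.
have f5 (x y : int) : p%:Z = qform 5 2 11 x y -> (p %% 3 = 2)%N -> shifting p.
  rewrite /qform => pE p3; exists (2 * x + 4 * y), (y - x); split.
    by right; rewrite pE; ring.
  apply/negP => /dvdzP[k kE]; have {kE}yE : y = k * 3 + x by lia.
  by rewrite yE in pE; lia.
have f7 (x y : int) : p%:Z = qform 7 6 9 x y -> (p %% 3 = 1)%N -> shifting p.
  rewrite /qform => pE p3; exists (x + 3 * y), x; split.
    by left; rewrite pE; ring.
  by apply/negP => /dvdzP[k kE]; rewrite kE in pE; lia.
case=> -[_ p24 [x [y pE]]]; [apply: f5 pE _|apply: f5 pE _|apply: f7 pE _|apply: f7 pE _];
  lia.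
Qed.

Lemma odd_sq_mod8 (x : int) : ~~ (2 %| x)%Z -> (x ^+ 2 %% 8)%Z = 1.
Proof.
move=> x2; have [k [j [-> kj]]] : exists k j, x = 2 * k + 1 /\ k * (k + 1) = 2 * j.
  exists (x %/ 2)%Z; set k := (x %/ 2)%Z.
  have [k2|k2] : (2 %| k)%Z \/ (2 %| k + 1)%Z by lia.
    by have /dvdzP[j jE] := k2; exists (j * (k + 1)); split; [lia | rewrite {1}jE; ring].
  by have /dvdzP[j jE] := k2; exists (k * j); split; [lia | rewrite jE; ring].
have -> : (2 * k + 1) ^+ 2 = 8 * j + 1 by lia.
lia.
Qed.

Lemma even_sq_mod4 (x : int) : (2 %| x)%Z -> (x ^+ 2 %% 4)%Z = 0.
Proof. by move=> /dvdzP[k ->]; lia. Qed.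

Lemma sq_mod3 (x : int) : ~~ (3 %| x)%Z -> (x ^+ 2 %% 3)%Z = 1.
Proof.
move=> x3; have [k [|] ->] : exists k, x = 3 * k + 1 \/ x = 3 * k - 1.
- by exists ((x + 1) %/ 3)%Z; lia.
- lia.
- lia.
Qed.

(** The congruence a = b mod 3 is what makes the changes of variables of
    [eligible_shifting] invertible over the integers, and squares modulo 8 and
    modulo 3 determine p mod 24. *)
Lemma shifting_eligible p : prime p -> (3 < p)%N -> shifting p -> eligible p.
Proof.
move=> pr_p p3 /(shifting_aligned pr_p p3)[a [b [abp b3 ba]]].
have a3 : ~~ (3 %| a)%Z by lia.
have podd : odd p by have := even_prime pr_p; lia.
have a3sq := sq_mod3 a3.
case: abp => abp.
  have [z zE] : exists z, a = b + 3 * z by exists ((a - b) %/ 3)%Z; lia.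
  have pE : exists x y, p%:Z = qform 7 6 9 x y.
    by exists b, z; rewrite -abp zE /qform; ring.
  have a2 : ~~ (2 %| a)%Z by apply/negP => /even_sq_mod4; lia.
  have a8 := odd_sq_mod8 a2.
  have [b2|b2] := boolP (2 %| b)%Z.
    have b4 := even_sq_mod4 b2.
    by constructor 3; split=> //; lia.
  have b8 := odd_sq_mod8 b2.
  by constructor 4; split=> //; lia.
have /dvdzP[u uE] : (2 %| a)%Z.
  by rewrite -(@Euclid_dvdzX2 2) //; apply/dvdzP; exists (p%:Z - 3 * b ^+ 2); lia.
have {}abp : 2 * u ^+ 2 + 3 * b ^+ 2 = p%:Z by rewrite uE in abp; lia.
have [w wE] : exists w, b = 3 * w - u by exists ((b + u) %/ 3)%Z; lia.
have pE : exists x y, p%:Z = qform 5 2 11 x y.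
  by exists (u - 2 * w), w; rewrite -abp wE /qform; ring.
have u3sq : (u ^+ 2 %% 3)%Z = 1 by apply: sq_mod3; lia.
have b2 : ~~ (2 %| b)%Z by apply/negP => /even_sq_mod4; lia.
have b8 := odd_sq_mod8 b2.
have [u2|u2] := boolP (2 %| u)%Z.
  have u4 := even_sq_mod4 u2.
  by constructor 1; split=> //; lia.
have u8 := odd_sq_mod8 u2.
by constructor 2; split=> //; lia.
Qed.

End Forms.

(** * Counting the prime factors in each residue class modulo 24 *)

Section Factorizations.

Lemma factors_as_eligible n k1 k2 k3 k4 p :
  factors_as n k1 k2 k3 k4 -> prime p -> p %| n -> eligible p.
Proof.
move=> [p1 [p2 [p3 [p4 [s1 s2 s3 s4 ->]]]]] pr_p.
have in_prod k (f : 'I_k -> nat) : (forall i, eligible (f i)) ->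
    p %| \prod_(i < k) f i -> eligible p.
  move=> elf; rewrite Euclid_dvd_prod // big_has => /hasP[i _].
  by rewrite dvdn_prime2 ?(eligible_prime (elf i)) // => /eqP ->.
rewrite !Euclid_dvdM // => /orP[/orP[/orP[]|]|]; apply: in_prod => i.
- by constructor 1.
- by constructor 2.
- by constructor 3.
- by constructor 4.
Qed.

Lemma squarefree_prod_primes m : 0 < m -> squarefree m ->
  m = \prod_(p <- primes m) p.
Proof.
move=> m0 sqf; rewrite {1}(prod_prime_decomp m0) prime_decompE big_map.
apply: eq_big_seq => p pm /=; have pr_p : prime p by move: pm; rewrite mem_primes => /andP[].
suff -> : logn p m = 1 by [].
have lt2 : ~~ (2 <= logn p m).
  apply/negP; rewrite -pfactor_dvdn // => /sqf p1.
  by rewrite p1 in pr_p.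
by move: pm; rewrite -logn_gt0; case: (logn p m) lt2 => [|[]].
Qed.

Lemma eqmodM (d a b a' b' : nat) :
  a = a' %[mod d] -> b = b' %[mod d] -> a * b = a' * b' %[mod d].
Proof. by move=> aE bE; rewrite -modnMm aE bE modnMm. Qed.

Lemma prod_mod_class (s : seq nat) (d r : nat) :
  \prod_(p <- s | p %% d == r) p = r ^ count (fun p => p %% d == r) s %[mod d].
Proof.
elim: s => [|x s IHs]; first by rewrite big_nil.
rewrite big_cons /=; case: eqP => // xr.
by rewrite add1n expnS -modnMmr IHs modnMmr -modnMml xr.
Qed.

Lemma prod_filter_nth (s : seq nat) (a : pred nat) :
  \prod_(p <- s | a p) p = \prod_(i < count a s) nth 0 (filter a s) i.
Proof. by rewrite -big_filter (big_nth 0) big_mkord size_filter. Qed.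

Lemma prod_classes (s : seq nat) : all (fun p => p %% 24 \in [:: 11; 5; 1; 7]) s ->
  \prod_(p <- s) p =
    (\prod_(p <- s | p %% 24 == 11) p) * (\prod_(p <- s | p %% 24 == 5) p) *
    (\prod_(p <- s | p %% 24 == 1) p) * (\prod_(p <- s | p %% 24 == 7) p).
Proof.
elim: s => [|x s IHs] /=; first by rewrite !big_nil.
case/andP=> xr /IHs sE; rewrite !big_cons sE.
by move: xr; rewrite !inE => /or4P[] /eqP -> /=; ring.
Qed.

Lemma expn_mod24 (r k : nat) : r ^ 2 = 1 %[mod 24] -> r ^ k = r ^ odd k %[mod 24].
Proof.
move=> r2; rewrite -{1}(odd_double_half k) expnD -mul2n expnM -modnMmr -modnXm r2.
by rewrite modnXm exp1n modnMmr muln1.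
Qed.

(** The factors are obtained by sorting the prime factors of m by their residue
    mod 24, which determines the set S1, ..., S4 they belong to. *)
Lemma eligible_factors m : 0 < m -> squarefree m ->
  (forall p, prime p -> p %| m -> eligible p) ->
  exists k1 k2 k3 k4, factors_as m k1 k2 k3 k4 /\
    m = 11 ^ k1 * 5 ^ k2 * 7 ^ k4 %[mod 24].
Proof.
move=> m0 sqf el; set s := primes m.
have els p : p \in s -> eligible p.
  by rewrite mem_primes => /and3P[pr_p _ pm]; apply: el.
have sall : all (fun p => p %% 24 \in [:: 11; 5; 1; 7]) s.
  by apply/allP => p /els; case=> -[_ pE _]; rewrite pE.
have mE := prod_classes sall; rewrite -(squarefree_prod_primes m0 sqf) in mE.
pose k r := count (fun p => p %% 24 == r) s.
exists (k 11), (k 5), (k 1), (k 7); split; last first.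
  have -> : 11 ^ k 11 * 5 ^ k 5 = 11 ^ k 11 * 5 ^ k 5 * 1 ^ k 1 by rewrite exp1n muln1.
  rewrite {1}mE.
  by do !apply: eqmodM; apply: prod_mod_class.
pose f r (i : 'I_(k r)) := nth 0 [seq p <- s | p %% 24 == r] i.
have fP r i : f r i %% 24 = r /\ eligible (f r i).
  have : f r i \in [seq p <- s | p %% 24 == r] by rewrite mem_nth // size_filter.
  by rewrite mem_filter => /andP[/eqP fr /els].
exists (f 11), (f 5), (f 1), (f 7); split=> [i|i|i|i|].
- by have [fr []] := fP _ i => // -[_ fr' _]; rewrite fr' in fr.
- by have [fr []] := fP _ i => // -[_ fr' _]; rewrite fr' in fr.
- by have [fr []] := fP _ i => // -[_ fr' _]; rewrite fr' in fr.
- by have [fr []] := fP _ i => // -[_ fr' _]; rewrite fr' in fr.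
- by rewrite {1}mE !prod_filter_nth.
Qed.

(** Since 11, 5 and 7 have square 1 mod 24, m = 11 mod 24 is a condition on the
    parities of the numbers of factors; it leaves (odd, even, even) and
    (even, odd, odd) for those in S1, S2, S4. *)
Lemma forms_iff_eligible m : 0 < m -> squarefree m -> m = 11 %[mod 24] ->
  (form_i m \/ form_ii m) <-> (forall p, prime p -> p %| m -> eligible p).
Proof.
move=> m0 sqf m24; split.
  by case=> [[t1 [t2 [t3 [t4 [_ fm]]]]]|[t1 [t2 [t3 [t4 [_ _ fm]]]]]] p;
    apply: factors_as_eligible fm.
move=> /(eligible_factors m0 sqf)[k1 [k2 [k3 [k4 [fm]]]]].
have -> : 11 ^ k1 * 5 ^ k2 * 7 ^ k4
    = 11 ^ odd k1 * 5 ^ odd k2 * 7 ^ odd k4 %[mod 24].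
  by do !apply: eqmodM; apply: expn_mod24.
rewrite m24.
have := odd_double_half k1; have := odd_double_half k2; have := odd_double_half k4.
case: (odd k1); case: (odd k2); case: (odd k4) => // e4 e2 e1 _.
  left; exists (k1./2.+1), k2./2, k3, k4./2; split; first by lia.
  have -> : 2 * k1./2.+1 - 1 = k1 by lia.
  have -> : 2 * k2./2 = k2 by lia.
  by have -> : 2 * k4./2 = k4 by lia.
right; exists k1./2, (k2./2.+1), k3, (k4./2.+1); split; [lia | lia |].
have -> : 2 * k1./2 = k1 by lia.
have -> : 2 * k2./2.+1 - 1 = k2 by lia.
by have -> : 2 * k4./2.+1 - 1 = k4 by lia.
Qed.

End Factorizations.

Theorem theorem2p1 (m : nat) (m_gt0 : 0 < m) (m_sqfree : squarefree m)
    (m_mod24 : m = 11 %[mod 24]) :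
  R m%:Z 5 2 11 = 2 %[mod 4] <-> (form_i m \/ form_ii m).
Proof.
have m3 : m = 2 %[mod 3] by move: m_mod24; clear; lia.
have m_gt1 : 1 < m by move: m_mod24; clear; lia.
have m_n2 : ~~ (2 %| m) by move: m_mod24; clear; lia.
have m_n3 : ~~ (3 %| m) by move: m_mod24; clear; lia.
rewrite -(rho_R m3) (rho1_mod4 m_sqfree m_gt1 m_n2 m_n3).
rewrite (forms_iff_eligible m_gt0 m_sqfree m_mod24).
split=> all_p p pr_p pm; last exact/eligible_shifting/all_p.
apply: (shifting_eligible pr_p) (all_p _ pr_p pm).
have [p2 p3] : p != 2 /\ p != 3.
  by split; apply/eqP => pE; move: pm; rewrite pE; [apply/negP: m_n2 | apply/negP: m_n3].
by have := prime_gt1 pr_p; lia.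
Qed.
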